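(* Let $A,B$ be complex $3\times 3$ matrices having the same minimal polynomial, and suppose this minimal polynomial has degree $2$. The following are equivalent: (1) $A$ and $B$ have identical pseudospectra (i.e. $\|(zI-A)^{-1}\|=\|(zI-B)^{-1}\|$ for all $z\in\mathbb{C}$) and $\chi_A=\chi_B$; (2) $A$ and $B$ are unitarily similar.
   Context: $\|\cdot\|$ is the spectral norm; by convention $\|(zI-T)^{-1}\|=\infty$ for $z$ an eigenvalue of $T$. $\chi_T(z)=\det(zI-T)$ is the characteristic polynomial. *)

(* Defs.v *)
From mathcomp Require Import all_boot all_order all_algebra.
From mathcomp Require Import complex.
From mathcomp Require Import classical_sets reals constructive_ereal.
Set Implicit Arguments. Unset Strict Implicit. Unset Printing Implicit Defensive.
Import Order.TTheory GRing.Theory Num.Theory.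
Local Open Scope ring_scope.
Local Open Scope classical_set_scope.

Section Defs.
Variable R : realType.

Definition sqmod (z : R[i]) : R := complex.Re z ^+ 2 + complex.Im z ^+ 2.

Definition vnorm2 n (x : 'cV[R[i]]_n) : R :=
  Num.sqrt (\sum_(k < n) sqmod (x k 0)).

Definition spec_norm n (M : 'M[R[i]]_n) : R :=
  sup [set vnorm2 (M *m x) | x in [set x : 'cV[R[i]]_n | vnorm2 x <= 1]].

Definition resolvent_norm n (z : R[i]) (T : 'M[R[i]]_n) : \bar R :=
  if (z%:M - T) \in unitmx then ((spec_norm (invmx (z%:M - T)))%:E)%E
  else (+oo)%E.

Definition ctrmx n (U : 'M[R[i]]_n) : 'M[R[i]]_n := (map_mx Num.conj U)^T.

Definition unitary n (U : 'M[R[i]]_n) : Prop := U *m ctrmx U = 1%:M.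

Definition unitarily_similar n (A B : 'M[R[i]]_n) : Prop :=
  exists U : 'M[R[i]]_n, unitary U /\ B = U *m A *m ctrmx U.

End Defs.

(* Main.v *)
Require Import Defs.
From mathcomp Require Import all_boot all_order all_algebra.
From mathcomp Require Import spectral complex.
From mathcomp Require Import classical_sets reals constructive_ereal.
From mathcomp Require Import ring lra.
Set Implicit Arguments.
Unset Strict Implicit.
Unset Printing Implicit Defensive.
Import Order.TTheory GRing.Theory Num.Theory.
Local Open Scope ring_scope.
Local Open Scope sesquilinear_scope.

(* A minimal polynomial (X - a)(X - b) on C^3 forces, up to exchanging a and b,
   T = a + N with N = u v^* of rank one (Sylvester's rank inequality) and
   trace b - a =: c; the traces of A and B pick the same a for both. Since
   N^2 = c N, the resolvent at z = a + c + e is ((c + e) e)^-1 (e + N), so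
   letting e tend to 0 the pseudospectrum determines |N| = |u| |v|. Finally, rank-one
   matrices with the same trace and norm are unitarily similar: one complex
   reflection carries u to u', and a second one, fixing u', carries v to v'. *)

(** * Hermitian product, complex reflections, rank-one matrices *)

Section HermitianProduct.
Variable C : numClosedFieldType.

Lemma trmxC_mul m n p (A : 'M[C]_(m, n)) (B : 'M[C]_(n, p)) :
  (A *m B)^t* = B^t* *m A^t*.
Proof. by rewrite trmx_mul map_mxM. Qed.

Definition hdot n (x y : 'cV[C]_n) : C := (x^t* *m y) 0 0.

Lemma hdot_mx n (x y : 'cV[C]_n) : x^t* *m y = (hdot x y)%:M.
Proof. exact: mx11_scalar. Qed.

Lemma hdotC n (x y : 'cV[C]_n) : (hdot x y)^* = hdot y x.
Proof.
rewrite /hdot !mxE rmorph_sum; apply: eq_bigr => k _.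
by rewrite !mxE rmorphM /= conjCK mulrC.
Qed.

Lemma hdotBl n (x y z : 'cV[C]_n) : hdot (x - y) z = hdot x z - hdot y z.
Proof. by rewrite /hdot linearB map_mxB mulmxBl !mxE. Qed.

Lemma hdotBr n (x y z : 'cV[C]_n) : hdot z (x - y) = hdot z x - hdot z y.
Proof. by rewrite /hdot mulmxBr !mxE. Qed.

Lemma hdotZl n k (x y : 'cV[C]_n) : hdot (k *: x) y = k^* * hdot x y.
Proof. by rewrite /hdot linearZ map_mxZ -scalemxAl mxE. Qed.

Lemma hdotZr n k (x y : 'cV[C]_n) : hdot x (k *: y) = k * hdot x y.
Proof. by rewrite /hdot -scalemxAr mxE. Qed.

Lemma hdot_unitary n (U : 'M[C]_n) (x y : 'cV[C]_n) :
  U \is unitarymx -> hdot (U *m x) (U *m y) = hdot x y.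
Proof. by move=> uU; rewrite /hdot trmxC_mul mulmxA mulmxKtV. Qed.

(** [dotmx] pairs row vectors and conjugates its second argument, hence the transposes and the swap.
    Definiteness, Cauchy-Schwarz and the triangle inequality are imported through this identity. *)
Lemma hdotE n (x y : 'cV[C]_n) : hdot x y = dotmx y^T x^T.
Proof.
rewrite dotmxE /hdot trmxK !mxE.
by apply: eq_bigr => k _; rewrite !mxE mulrC.
Qed.

Lemma hdot_eq0 n (x : 'cV[C]_n) : (hdot x x == 0) = (x == 0).
Proof. by rewrite hdotE dnorm_eq0 trmx_eq0. Qed.

Lemma mulmx_rank1 n (u v x : 'cV[C]_n) :
  (u *m v^t*) *m x = hdot v x *: u.
Proof. by rewrite -mulmxA hdot_mx mul_mx_scalar. Qed.

Lemma mxtrace_rank1 n (u v : 'cV[C]_n) : \tr (u *m v^t*) = hdot v u.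
Proof. by rewrite mxtrace_mulC hdot_mx mxtrace_scalar. Qed.

(* The complex reflection along w := x - y; the equality of norms is
   exactly what makes twice the real part of <w, x> equal to <w, w>. *)
Lemma unitary_move n (x y : 'cV[C]_n) : hdot x x = hdot y y ->
  exists U : 'M[C]_n, [/\ U \is unitarymx, U *m x = y &
    forall z, hdot x z = hdot y z -> U *m z = z].
Proof.
move=> eq_xy; have [<-|neq_xy] := eqVneq x y.
  exists 1%:M; split=> [||z _]; rewrite ?mul1mx //.
  by apply/unitarymxP; rewrite mul1mx trmx1 map_mx1.
pose w := x - y; pose a := hdot w x; pose W := w *m w^t*.
have aD : a + a^* = hdot w w.
  by rewrite /a hdotC !hdotBl !hdotBr eq_xy; ring.
have W2 : W *m W = (a + a^*) *: W by rewrite aD mulmxA mulmx_rank1 -scalemxAl.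
have a_neq0 : a != 0.
  apply: contra_neq neq_xy => a0; apply/eqP; rewrite -subr_eq0 -hdot_eq0.
  by rewrite -aD a0 conjC0 addr0.
have ca_neq0 : a^* != 0 by rewrite conjC_eq0.
(* Since [W *m x = a *: w], the factor [a^-1] sends [x] to [x - w = y]. With [c] the conjugate of
   [a], unitarity reduces to [1/a + 1/c = (a + c)/(a c)]. *)
exists (1%:M - a^-1 *: W); split=> [||z xz].
- apply/unitarymxP; rewrite linearB map_mxB /= trmx1 map_mx1.
  rewrite [(_ *: W)^T]linearZ /= map_mxZ.
  rewrite trmxC_mul trmxCK -/W mulmxBl mul1mx mulmxBr mulmx1 -scalemxAl.
  rewrite -scalemxAr W2 !scalerA -scalerBl -addrA -opprD -scalerDl.
  rewrite [X in X *: W](_ : _ = 0) ?scale0r ?subr0 //=.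
  by rewrite fmorphV; field; rewrite a_neq0 ca_neq0.
- rewrite mulmxBl mul1mx -scalemxAl mulmx_rank1 scalerA mulVf // scale1r.
  by rewrite subKr.
- rewrite mulmxBl mul1mx -scalemxAl mulmx_rank1 hdotBl xz subrr scale0r.
  by rewrite scaler0 subr0.
Qed.

Lemma rank1_unitarily_similar n (u v u' v' : 'cV[C]_n) :
  hdot u u = hdot u' u' -> hdot v v = hdot v' v' -> hdot v u = hdot v' u' ->
  exists2 U : 'M[C]_n, U \is unitarymx &
    u' *m v'^t* = U *m (u *m v^t*) *m U^t*.
Proof.
move=> eq_u eq_v eq_vu; have [U [uU Uu _]] := unitary_move eq_u.
have [V [uV Vv Vfix]] : exists V : 'M[C]_n, [/\ V \is unitarymx,
    V *m (U *m v) = v' & forall z, hdot (U *m v) z = hdot v' z -> V *m z = z].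
  by apply: unitary_move; rewrite hdot_unitary.
exists (V *m U); first exact: mul_unitarymx.
(* [Vfix] applies to [u' = U *m u], because [hdot (U *m v) u' = hdot v u = hdot v' u']. *)
have -> : u' = V *m U *m u.
  by rewrite -mulmxA Uu Vfix // -{1}Uu hdot_unitary.
by rewrite -{1}Vv mulmxA !trmxC_mul !mulmxA.
Qed.

End HermitianProduct.

(** * Vector norms, the spectral norm and unitary invariance *)

Section SpectralNorm.
Variable R : realType.
Implicit Types (k z : R[i]).

(** A modulus with values in [R], like [spec_norm]; the norm [|z|] lives in [R[i]]. *)
Definition cmod z : R := Num.sqrt (sqmod z).

Lemma sqmod_ge0 z : 0 <= sqmod z.
Proof. by rewrite addr_ge0 ?sqr_ge0. Qed.

Lemma sqmodE z : (sqmod z)%:C%C = `|z| ^+ 2.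
Proof. exact: add_Re2_Im2. Qed.

Lemma cmodE z : (cmod z)%:C%C = `|z|.
Proof. by rewrite normc_def. Qed.

Lemma cmod_ge0 z : 0 <= cmod z.
Proof. exact: sqrtr_ge0. Qed.

Lemma cmod_gt0 z : z != 0 -> 0 < cmod z.
Proof. by rewrite -ltcR cmodE normr_gt0. Qed.

Lemma cmod_real (r : R) : 0 <= r -> cmod r%:C%C = r.
Proof. by move=> r0; apply: complexI; rewrite cmodE ger0_norm // ler0c. Qed.

Section Vectors.
Variable n : nat.
Implicit Types (u v x y : 'cV[R[i]]_n).

Lemma vnorm2_ge0 x : 0 <= vnorm2 x.
Proof. exact: sqrtr_ge0. Qed.

Lemma vnorm2_sqr x : ((vnorm2 x)%:C%C) ^+ 2 = hdot x x.
Proof.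
rewrite -rmorphXn /= sqr_sqrtr; last first.
  by apply: sumr_ge0 => i _; exact: sqmod_ge0.
rewrite rmorph_sum /hdot mxE; apply: eq_bigr => i _ /=.
by rewrite sqmodE normCKC !mxE.
Qed.

Lemma vnorm2E x : (vnorm2 x)%:C%C = sqrtC (dotmx x^T x^T).
Proof. by rewrite -hdotE -vnorm2_sqr sqrCK // ler0c vnorm2_ge0. Qed.

Lemma eq_vnorm2 x y : hdot x x = hdot y y -> vnorm2 x = vnorm2 y.
Proof. by move=> e; apply: complexI; rewrite !vnorm2E -!hdotE e. Qed.

Lemma vnorm2_eq0 x : (vnorm2 x == 0) = (x == 0).
Proof. by rewrite -hdot_eq0 -vnorm2_sqr sqrf_eq0 fmorph_eq0. Qed.

Lemma vnorm2D x y : vnorm2 (x + y) <= vnorm2 x + vnorm2 y.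
Proof.
rewrite -lecR rmorphD /= !vnorm2E linearD /=.
by have [] := triangle_lerif (@dotmx _ n) x^T y^T.
Qed.

Lemma vnorm2Z k x : vnorm2 (k *: x) = cmod k * vnorm2 x.
Proof.
apply/eqP; rewrite -(@eqrXn2 _ 2) ?mulr_ge0 ?vnorm2_ge0 ?cmod_ge0 //.
apply/eqP/complexI; rewrite !rmorphXn rmorphM /= exprMn !vnorm2_sqr cmodE.
by rewrite hdotZl hdotZr mulrA normCKC.
Qed.

Lemma vnorm20 : vnorm2 (0 : 'cV[R[i]]_n) = 0.
Proof. by apply/eqP; rewrite vnorm2_eq0. Qed.

Lemma cmod_hdot_le x y : cmod (hdot x y) <= vnorm2 x * vnorm2 y.
Proof.
rewrite -lecR cmodE rmorphM /= !vnorm2E hdotE mulrC.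
by have [] := CauchySchwarz_sqrt (@dotmx _ n) y^T x^T.
Qed.

Lemma vnorm2_unitary (U : 'M[R[i]]_n) x :
  U \is unitarymx -> vnorm2 (U *m x) = vnorm2 x.
Proof. by move=> uU; apply: eq_vnorm2; rewrite hdot_unitary. Qed.

End Vectors.

Lemma spec_norm_le n (M : 'M[R[i]]_n) (K : R) :
  (forall x, vnorm2 x <= 1 -> vnorm2 (M *m x) <= K) -> spec_norm M <= K.
Proof.
move=> MK; apply: ge_sup; last by move=> _ [x x1 <-]; exact: MK.
by exists (vnorm2 (M *m 0)), 0 => //=; rewrite vnorm20 ler01.
Qed.

(** The bound [K] guards against the default value that [sup] takes on an unbounded set. *)
Lemma le_spec_norm n (M : 'M[R[i]]_n) (K : R) x :
  (forall x, vnorm2 x <= 1 -> vnorm2 (M *m x) <= K) -> vnorm2 x <= 1 ->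
  vnorm2 (M *m x) <= spec_norm M.
Proof.
move=> MK x1; apply: ub_le_sup; last by exists x.
by exists K => _ [y y1 <-]; exact: MK.
Qed.

(** Both suprema range over the same set: [U] permutes the unit ball and preserves the norms of
    images. *)
Lemma spec_norm_unitary n (U M : 'M[R[i]]_n) :
  U \is unitarymx -> spec_norm (U *m M *m U^t*) = spec_norm M.
Proof.
move=> uU; have uU' : U^t* \is unitarymx by rewrite trmxC_unitary.
rewrite /spec_norm; congr sup.
apply/seteqP; split=> [_ [x /= x1 <-]|_ [x /= x1 <-]].
  exists (U^t* *m x); first by rewrite /= vnorm2_unitary.
  by rewrite -!mulmxA (vnorm2_unitary _ uU).
exists (U *m x); first by rewrite /= vnorm2_unitary.
by rewrite -!mulmxA (vnorm2_unitary _ uU) [U^t* *m _]mulmxA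
           (mulmx1C (unitarymxP uU)) mul1mx.
Qed.

Lemma invmx_of_mul1 n (M N : 'M[R[i]]_n) : M *m N = 1%:M -> invmx M = N.
Proof.
by move=> MN; have [uM _] := mulmx1_unit MN; rewrite -[N](mulKmx uM) MN mulmx1.
Qed.

Lemma resolvent_norm_unit n z (T : 'M[R[i]]_n) : z%:M - T \in unitmx ->
  resolvent_norm z T = (spec_norm (invmx (z%:M - T)))%:E.
Proof. by rewrite /resolvent_norm => ->. Qed.

Lemma resolvent_norm_nonunit n z (T : 'M[R[i]]_n) : z%:M - T \notin unitmx ->
  resolvent_norm z T = +oo%E.
Proof. by rewrite /resolvent_norm => /negPf ->. Qed.

Lemma resolvent_norm_unitary n (U A : 'M[R[i]]_n) z :
  U \is unitarymx ->
  resolvent_norm z (U *m A *m U^t*) = resolvent_norm z A.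
Proof.
move=> uU; have UV : U *m U^t* = 1%:M := unitarymxP uU.
have [Uu Uu'] := mulmx1_unit UV.
have zU : z%:M - U *m A *m U^t* = U *m (z%:M - A) *m U^t*.
  by rewrite mulmxBr mulmxBl scalar_mxC -(mulmxA z%:M) UV mulmx1.
have zunit : (z%:M - U *m A *m U^t* \in unitmx) = (z%:M - A \in unitmx).
  by rewrite zU !unitmx_mul Uu Uu' andbT.
have invU : z%:M - A \in unitmx ->
    invmx (z%:M - U *m A *m U^t*) = U *m invmx (z%:M - A) *m U^t*.
  move=> zA; apply: invmx_of_mul1; rewrite zU.
  rewrite !mulmxA -(mulmxA _ (U^t*) U) (mulmx1C UV) mulmx1.
  by rewrite -[U *m _ *m invmx _]mulmxA mulmxV // mulmx1.
have [zA|zA] := boolP (z%:M - A \in unitmx).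
  have zB : z%:M - U *m A *m U^t* \in unitmx by rewrite zunit.
  by rewrite (resolvent_norm_unit zB) (resolvent_norm_unit zA) (invU zA)
             (spec_norm_unitary _ uU).
have zB : z%:M - U *m A *m U^t* \notin unitmx by rewrite zunit.
by rewrite (resolvent_norm_nonunit zB) (resolvent_norm_nonunit zA).
Qed.

(** * Resolvent norms of a scalar plus a rank-one matrix *)

Section RankOne.
Variable n : nat.
Implicit Types (u v x : 'cV[R[i]]_n).

(** Triangle inequality and Cauchy-Schwarz. It serves twice: as the upper estimate of the spectral
    norm, and as the boundedness behind the lower one. *)
Lemma rank1_perturb_le k e u v x : vnorm2 x <= 1 ->
  vnorm2 (k *: (e%:M + u *m v^t*) *m x) <=
  cmod k * (vnorm2 u * vnorm2 v + cmod e).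
Proof.
move=> x1; rewrite -scalemxAl vnorm2Z ler_wpM2l ?cmod_ge0 // mulmxDl.
rewrite mul_scalar_mx mulmx_rank1 (le_trans (vnorm2D _ _)) // !vnorm2Z addrC.
rewrite lerD ?ler_piMr ?cmod_ge0 // mulrC ler_wpM2l ?vnorm2_ge0 //.
by rewrite (le_trans (cmod_hdot_le _ _)) // ler_piMr ?vnorm2_ge0.
Qed.

Lemma spec_norm_rank1_le k e u v :
  spec_norm (k *: (e%:M + u *m v^t*)) <=
  cmod k * (vnorm2 u * vnorm2 v + cmod e).
Proof. by apply: spec_norm_le => x; exact: rank1_perturb_le. Qed.

(* The bound is attained, up to [cmod e], at the normalisation of [v]; the
   convention [0^-1 = 0] covers the case [v = 0]. *)
Lemma spec_norm_rank1_ge k e u v :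
  cmod k * (vnorm2 u * vnorm2 v - cmod e) <=
  spec_norm (k *: (e%:M + u *m v^t*)).
Proof.
pose x := ((vnorm2 v)^-1)%:C%C *: v.
have nx : vnorm2 x <= 1.
  rewrite vnorm2Z cmod_real ?invr_ge0 ?vnorm2_ge0 //.
  by have [->|v0] := eqVneq (vnorm2 v) 0; rewrite ?mulr0 ?ler01 // mulVf.
have vx : hdot v x = (vnorm2 v)%:C%C.
  rewrite hdotZr -vnorm2_sqr -rmorphXn -rmorphM /=; congr (_%:C%C).
  have [->|v0] := eqVneq (vnorm2 v) 0; first by rewrite expr0n mulr0.
  by rewrite expr2 mulKf.
apply: le_trans (le_spec_norm (@rank1_perturb_le k e u v) nx).
rewrite -scalemxAl vnorm2Z ler_wpM2l ?cmod_ge0 // mulmxDl mul_scalar_mx.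
rewrite mulmx_rank1 vx lerBlDr.
have -> : vnorm2 u * vnorm2 v = vnorm2 ((vnorm2 v)%:C%C *: u).
  by rewrite vnorm2Z cmod_real ?vnorm2_ge0 // mulrC.
(* Reverse triangle inequality: the vector is rewritten as its sum with [e *: x], minus [e *: x]. *)
rewrite -{1}[_ *: u](addKr (e *: x)) addrC -[- _ in X in X <= _]scaleN1r.
rewrite (le_trans (vnorm2D _ _)) // lerD2l scalerA vnorm2Z.
have -> : cmod (-1 * e) = cmod e.
  by apply: complexI; rewrite !cmodE mulN1r normrN.
by rewrite ler_piMr ?cmod_ge0.
Qed.

(** With [w = c + e] and [N^2 = c N], one gets [(w - N)(e + N) = w e + (w - e - c) N = w e]. *)
Lemma resolvent_norm_rank1 a c e u v :
  hdot v u = c -> c + e != 0 -> e != 0 ->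
  resolvent_norm (a + (c + e)) (a%:M + u *m v^t*) =
  (spec_norm (((c + e) * e)^-1 *: (e%:M + u *m v^t*)))%:E.
Proof.
move=> vu w0 e0; set N := u *m v^t*; set w := c + e in w0 *.
set k := (w * e)^-1.
have inv : ((a + w)%:M - (a%:M + N)) *m (k *: (e%:M + N)) = 1%:M.
  have -> : (a + w)%:M - (a%:M + N) = w%:M - N.
    by rewrite raddfD /= opprD addrACA subrr add0r.
  have N2 : N *m N = c *: N by rewrite -vu mulmxA mulmx_rank1 -scalemxAl.
  rewrite -scalemxAr mulmxBl !mulmxDr -scalar_mxM mul_scalar_mx.
  rewrite mul_mx_scalar N2.
  rewrite -scalerDl [e + c]addrC -/w addrK scale_scalar_mx mulVf //.
  by rewrite mulf_neq0.
have [u1 _] := mulmx1_unit inv.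
by rewrite (resolvent_norm_unit u1) (invmx_of_mul1 inv).
Qed.

(** At each admissible real [e > 0] the two spectral norms agree and carry the same positive factor
    [cmod k]; cancelling it compares the lower estimate for one matrix with the upper one for the
    other. *)
Lemma resolvent_norm_rank1_le a u v u' v' : hdot v u = hdot v' u' ->
  (forall z, resolvent_norm z (a%:M + u *m v^t*) =
             resolvent_norm z (a%:M + u' *m v'^t*)) ->
  vnorm2 u * vnorm2 v <= vnorm2 u' * vnorm2 v'.
Proof.
move=> eq_c eq_res; set c := hdot v u in eq_c.
have bound (e : R) : 0 < e -> c + e%:C%C != 0 ->
    vnorm2 u * vnorm2 v <= vnorm2 u' * vnorm2 v' + e + e.
  move=> e0 w0; have ce0 : e%:C%C != 0 :> R[i] by rewrite fmorph_eq0 gt_eqF.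
  have := eq_res (a + (c + e%:C%C)).
  rewrite (resolvent_norm_rank1 _ (erefl c) w0 ce0).
  rewrite (resolvent_norm_rank1 _ (esym eq_c) w0 ce0) => eq_E.
  have eq_s := EFin_inj eq_E.
  have := spec_norm_rank1_ge ((c + e%:C%C) * e%:C%C)^-1 e%:C%C u v.
  rewrite eq_s => /le_trans /(_ (spec_norm_rank1_le _ _ _ _)).
  have k0 : 0 < cmod ((c + e%:C%C) * e%:C%C)^-1.
    by apply: cmod_gt0; rewrite invr_eq0; apply: mulf_neq0.
  by rewrite (ler_pM2l k0) lerBlDr (cmod_real (ltW e0)).
rewrite leNgt; apply/negP => lt.
pose d := vnorm2 u * vnorm2 v - vnorm2 u' * vnorm2 v'.
have d0 : 0 < d by rewrite subr_gt0.
have dE : vnorm2 u * vnorm2 v = d + vnorm2 u' * vnorm2 v' by rewrite subrK.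
(* Any [e < d / 2] contradicts [bound]. Two candidates suffice, as [c + e] vanishes for at most one
   [e]. *)
have [c3|c3] := eqVneq (c + (d / 3)%:C%C) 0; last first.
  by have := bound (d / 3) ltac:(lra) c3; lra.
have c4 : c + (d / 4)%:C%C != 0.
  rewrite -[c](addrK (d / 3)%:C%C) c3 sub0r addrC subr_eq0; apply/eqP.
  by move/complexI; lra.
by have := bound (d / 4) ltac:(lra) c4; lra.
Qed.

End RankOne.

End SpectralNorm.

(** * From a quadratic minimal polynomial to a rank-one perturbation *)

Section QuadraticMinPoly.
Variable C : numClosedFieldType.

Lemma rank_le1P n (N : 'M[C]_n) : (\rank N <= 1)%N ->
  exists u v : 'cV[C]_n, N = u *m v^t*.
Proof.
move: (mulmx_base N); move: (col_base N) (row_base N).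
(* The inner dimension of the factorisation is the rank: 0 gives the zero matrix, 1 a column times a
   row. *)
case: (\rank N) => [|[|//]] L M LM _.
  by exists 0, 0; rewrite mul0mx -LM [L]thinmx0 mul0mx.
by exists L, (M^t*); rewrite trmxCK.
Qed.

Lemma mxminpoly_split (A : 'M[C]_3) : size (mxminpoly A) = 3%N ->
  exists a b, mxminpoly A = ('X - a%:P) * ('X - b%:P).
Proof.
have [r] := closed_field_poly_normal (mxminpoly A).
rewrite (monicP (mxminpoly_monic A)) scale1r => ->.
rewrite size_prod_XsubC => -[].
case: r => [|a [|b [|]]] // _; exists a, b.
by rewrite !big_cons big_nil mulr1.
Qed.

(** If [N = u *m v^t*] vanished, ['X - a%:P] would annihilate [A], against degree 2. Then [0 = N (N
    - (b - a)) = (hdot v u - (b - a)) N] gives the trace of [N]. *)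
Lemma mxminpoly_rank1_of_rank (A : 'M[C]_3) a b :
  mxminpoly A = ('X - a%:P) * ('X - b%:P) -> (\rank (A - a%:M)%R <= 1)%N ->
  exists u v : 'cV[C]_3,
    [/\ A = a%:M + u *m v^t*, u *m v^t* != 0 & hdot v u = b - a].
Proof.
move=> pA /rank_le1P[u [v Nuv]]; exists u, v.
have AE : A = a%:M + u *m v^t* by rewrite -Nuv addrC subrK.
have N0 : u *m v^t* != 0.
  apply/eqP => N0; have: mxminpoly A %| 'X - a%:P.
    by apply: mxminpoly_min; rewrite rmorphB /= horner_mx_X horner_mx_C Nuv.
  move/(dvdp_leq (negbT (polyXsubC_eq0 a))) => /=.
  by rewrite pA size_mul ?polyXsubC_eq0 // !size_XsubC.
split=> //; have := mx_root_minpoly A.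
rewrite pA rmorphM !rmorphB /= horner_mx_X !horner_mx_C Nuv.
have -> : A - b%:M = u *m v^t* - (b - a)%:M.
  by rewrite AE raddfB /= opprB [a%:M + _]addrC addrA.
rewrite -[_ * _]/(_ *m _) mulmxBr mulmxA mulmx_rank1 -scalemxAl mul_mx_scalar.
rewrite -scalerBl => /eqP.
by rewrite scaler_eq0 (negPf N0) orbF subr_eq0 => /eqP.
Qed.

Lemma mxminpoly_rank1 (A : 'M[C]_3) a b :
  mxminpoly A = ('X - a%:P) * ('X - b%:P) ->
  (\rank (A - a%:M)%R <= 1)%N \/ (\rank (A - b%:M)%R <= 1)%N.
Proof.
move=> pA; have := mx_root_minpoly A.
rewrite pA rmorphM !rmorphB /= horner_mx_X !horner_mx_C => /mulmx0_rank_max rk.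
have [rA|rA] := leqP (\rank (A - a%:M)%R) 1; [by left|right].
(* The ranks add up to at most 3, and [2 + r <= 3] computes to [r <= 1]. *)
exact: leq_trans (leq_add rA (leqnn _)) rk.
Qed.

(** If [B] had its rank-one shift at [b] instead, the traces would be [2a + b] and [2b + a], forcing
    [a = b]. *)
Lemma mxminpoly_rank1_trace (A B : 'M[C]_3) a b :
  mxminpoly A = ('X - a%:P) * ('X - b%:P) -> mxminpoly A = mxminpoly B ->
  \tr A = \tr B -> (\rank (A - a%:M)%R <= 1)%N -> (\rank (B - a%:M)%R <= 1)%N.
Proof.
move=> pA pAB trAB rA.
have pB : mxminpoly B = ('X - a%:P) * ('X - b%:P) by rewrite -pAB.
have [//|rB] := mxminpoly_rank1 pB.
have pB' : mxminpoly B = ('X - b%:P) * ('X - a%:P) by rewrite mulrC.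
have [u [v [AE _ vu]]] := mxminpoly_rank1_of_rank pA rA.
have [u' [v' [BE _ vu']]] := mxminpoly_rank1_of_rank pB' rB.
suff -> : a = b by [].
move: trAB; rewrite AE BE !mxtraceD !mxtrace_scalar !mxtrace_rank1 vu vu'.
move=> tr; apply/eqP; rewrite -subr_eq0; apply/eqP.
transitivity ((a *+ 3 + (b - a)) - (b *+ 3 + (a - b))); first ring.
by rewrite tr subrr.
Qed.

End QuadraticMinPoly.

(** * Unitary similarity and the equivalence *)

Lemma rank1_shift_unitarily_similar (R : realType) n (a : R[i])
    (u v u' v' : 'cV[R[i]]_n) :
  u *m v^t* != 0 -> u' *m v'^t* != 0 -> hdot v u = hdot v' u' ->
  vnorm2 u * vnorm2 v = vnorm2 u' * vnorm2 v' ->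
  exists2 U : 'M[R[i]]_n, U \is unitarymx &
    a%:M + u' *m v'^t* = U *m (a%:M + u *m v^t*) *m U^t*.
Proof.
move=> N0 N0' eq_c eq_n.
have u0 : vnorm2 u != 0.
  apply: contraNneq N0 => /eqP; rewrite vnorm2_eq0 => /eqP ->.
  by rewrite mul0mx.
have u0' : vnorm2 u' != 0.
  apply: contraNneq N0' => /eqP; rewrite vnorm2_eq0 => /eqP ->.
  by rewrite mul0mx.
(* Only the product of the norms is known to agree. Replacing [u'], [v'] by [t u'], [v' / t] keeps
   the rank-one matrix, since [t] is real, and matches each norm separately. *)
pose t : R := vnorm2 u / vnorm2 u'.
have t0 : t != 0 by rewrite mulf_neq0 ?invr_eq0.
have t_ge0 : 0 <= t by rewrite divr_ge0 ?vnorm2_ge0.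
have tC0 : t%:C%C != 0 :> R[i] by rewrite fmorph_eq0.
have tJ (r : R) : (r%:C%C)^* = r%:C%C :> R[i] by exact: conjc_real.
have [||| U uU UE] := @rank1_unitarily_similar _ n u v (t%:C%C *: u')
    ((t^-1)%:C%C *: v').
- rewrite -!vnorm2_sqr vnorm2Z cmod_real //; congr (_%:C%C ^+ _).
  by rewrite mulfVK.
- rewrite -!vnorm2_sqr vnorm2Z cmod_real ?invr_ge0 //; congr (_%:C%C ^+ _).
  by apply: (mulfI u0); rewrite eq_n /t; field; rewrite u0 u0'.
- by rewrite hdotZl hdotZr tJ fmorphV mulKf.
exists U; first exact: uU.
rewrite mulmxDr mulmxDl scalar_mxC -(mulmxA a%:M).
rewrite (unitarymxP uU) mulmx1; congr (_ + _); rewrite -UE.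
rewrite linearZ map_mxZ /= tJ -scalemxAl -scalemxAr scalerA fmorphV.
by rewrite divff // scale1r.
Qed.

Lemma unitarily_similarP (R : realType) n (A B : 'M[R[i]]_n) :
  unitarily_similar A B <->
  exists2 U : 'M[R[i]]_n, U \is unitarymx & B = U *m A *m U^t*.
Proof.
have ctrE (U : 'M[R[i]]_n) : ctrmx U = U^t* by rewrite /ctrmx map_trmx.
split=> [[U []]|[U]]; rewrite /unitary ?ctrE.
  by move=> uU BE; exists U => //; apply/unitarymxP.
by move=> /unitarymxP uU BE; exists U; rewrite /unitary ctrE.
Qed.

(** Lifted to polynomial matrices, [U] commutes with the scalar matrix of ['X]. *)
Lemma char_poly_unitary (C : numClosedFieldType) n (U A : 'M[C]_n) :
  U \is unitarymx -> char_poly (U *m A *m U^t*) = char_poly A.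
Proof.
move=> uU; pose P := map_mx polyC : 'M[C]_n -> 'M[{poly C}]_n.
have UV : P U *m P (U^t*) = 1%:M by rewrite -map_mxM (unitarymxP uU) map_mx1.
rewrite /char_poly.
have -> : char_poly_mx (U *m A *m U^t*) = P U *m char_poly_mx A *m P (U^t*).
  rewrite /char_poly_mx mulmxBr mulmxBl scalar_mxC -(mulmxA 'X%:M) UV mulmx1.
  by rewrite !map_mxM.
by rewrite !det_mulmx mulrAC -det_mulmx UV det1 mul1r.
Qed.

Theorem theorem11 (R : realType) (A B : 'M[R[i]]_3) :
  mxminpoly A = mxminpoly B ->
  size (mxminpoly A) = 3%N ->
  ((forall z : R[i], resolvent_norm z A = resolvent_norm z B) /\
    char_poly A = char_poly B)
  <-> unitarily_similar A B.
Proof.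
move=> eq_min sz; apply: iff_trans (iff_sym (unitarily_similarP A B)).
split=> [[eq_res eq_char]|[U uU ->]]; last first.
  by split=> [z|]; rewrite ?resolvent_norm_unitary ?char_poly_unitary.
have tr : \tr A = \tr B.
  have trE (M : 'M[R[i]]_3) := char_poly_trace M (isT : 0 < 3)%N.
  by apply: oppr_inj; rewrite -(trE A) -(trE B) eq_char.
(* The roots are named so that the rank-one shift of [A] occurs at [a]; [rB] then puts that of [B]
   at the same [a]. *)
have [a [b [pA rA]]] : exists a b,
    mxminpoly A = ('X - a%:P) * ('X - b%:P) /\ (\rank (A - a%:M)%R <= 1)%N.
  have [a [b pA]] := mxminpoly_split sz.
  have [rA|rA] := mxminpoly_rank1 pA.
    exact: ex_intro (ex_intro _ b (conj pA rA)).
  exact: ex_intro (ex_intro _ a (conj (etrans pA (mulrC _ _)) rA)).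
have rB := mxminpoly_rank1_trace pA eq_min tr rA.
have pB := etrans (esym eq_min) pA.
have [u [v [AE N0 vu]]] := mxminpoly_rank1_of_rank pA rA.
have [u' [v' [BE N0' vu']]] := mxminpoly_rank1_of_rank pB rB.
have eq_c := etrans vu (esym vu').
rewrite AE BE in eq_res *.
have le_uv := resolvent_norm_rank1_le eq_c eq_res.
have le_vu := resolvent_norm_rank1_le (esym eq_c) (fun z => esym (eq_res z)).
have eq_n : vnorm2 u * vnorm2 v = vnorm2 u' * vnorm2 v'.
  by apply/le_anti; rewrite le_uv le_vu.
exact: rank1_shift_unitarily_similar N0 N0' eq_c eq_n.
Qed.
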